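(* Let $\mathbf{f}_1(t),\dots,\mathbf{f}_n(t)\in\mathbb{Z}[t]^m$, for $t\in\mathbb{N}$ let $\Lambda_t=\operatorname{Span}_{\mathbb{Z}}\{\mathbf{f}_1(t),\dots,\mathbf{f}_n(t)\}\subseteq\mathbb{Z}^m$, and let $\mathbf{x}(t)\in\mathbb{Q}(t)^m$. Then there exists $\mathbf{u}:\mathbb{N}\to\mathbb{Z}^m$ all of whose coordinate functions are eventually quasi-polynomial (EQP) such that $\mathbf{u}(t)$ is a vector of $\Lambda_t$ closest (in the Euclidean norm) to $\mathbf{x}(t)$.
   Context: A function $g:\mathbb{N}\to\mathbb{Q}$ is eventually quasi-polynomial (EQP) if there exist $N\in\mathbb{N}$ and polynomials $g_0,\dots,g_{N-1}\in\mathbb{Q}[t]$ such that for all sufficiently large $t$, $g(t)=g_i(t)$ whenever $t\equiv i\pmod N$. *)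

(* Defs.v *)
From HB Require Import structures.
From mathcomp Require Import all_boot all_order all_algebra.
From mathcomp Require Import reals.

Set Implicit Arguments.
Unset Strict Implicit.
Unset Printing Implicit Defensive.

Import Order.TTheory GRing.Theory Num.Theory.
Local Open Scope ring_scope.

Definition eventually_quasi_poly (g : nat -> rat) : Prop :=
  exists (N : nat) (p : 'I_N -> {poly rat}),
    (0 < N)%N /\
    exists T : nat, forall t : nat, (T <= t)%N ->
      forall i : 'I_N, (t = i %[mod N])%N -> g t = (p i).[t%:R].

(* [ratfun_value r a y]: the rational function r is defined at a, with value y.
   Some fraction p / q representing r must have q.[a] != 0 (r may also have
   unreduced representations whose denominator vanishes at a); y does not
   depend on the choice of such a fraction, and none exists at a pole of r. *)
Definition ratfun_value (r : {fraction {poly rat}}) (a y : rat) : Prop :=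
  exists p q : {poly rat},
    [/\ r = tofrac p / tofrac q, q.[a] != 0 & y = p.[a] / q.[a]].

Definition eval_polyrV (m : nat) (f : 'rV[{poly int}]_m) (t : nat) : 'rV[int]_m :=
  map_mx (fun p : {poly int} => p.[t%:R]) f.

Definition lattice_at (m n : nat) (f : 'I_n -> 'rV[{poly int}]_m) (t : nat)
    (v : 'rV[int]_m) : Prop :=
  inIntSpan [tuple eval_polyrV (f i) t | i < n] v.

Definition enorm (R : realType) (m : nat) (v : 'rV[R]_m) : R :=
  Num.sqrt (\sum_(i < m) v 0 i ^+ 2).

Definition edist (R : realType) (m : nat) (u : 'rV[int]_m) (y : 'rV[rat]_m) : R :=
  enorm (map_mx intr u - map_mx ratr y).

Definition closest_vector (R : realType) (m : nat) (L : 'rV[int]_m -> Prop)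
    (y : 'rV[rat]_m) (u : 'rV[int]_m) : Prop :=
  L u /\ forall v : 'rV[int]_m, L v -> edist R u y <= edist R v y.

(* Main.v *)
(* The degree in t turns the problem into lattice reduction over a
   non-archimedean field: since squares of real numbers do not cancel, the degree
   of a vector of polynomials is the largest degree of its entries. As long as
   the leading coefficient vectors of the generators satisfy an integer relation,
   some generator of top degree can be replaced by one of smaller degree without
   changing the lattice. Euclid's algorithm concentrates the relation on a single
   top-degree generator with coefficient a, and along each progression
   t = |a| s + r the coefficients of the other ones become divisible by a. When
   the leading vectors are independent, the rows are almost orthogonal for large t.
   Then, for a row of maximal degree, the coordinate of a closest vector lies
   within a bounded distance of the corresponding coordinate of the orthogonal
   projection of the target, hence, along suitable progressions, of an integer
   polynomial. This leaves finitely many candidates, each of which reduces the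
   problem to one row less; the best candidate is eventually the same on each
   residue class. *)
Require Import Defs.
From mathcomp Require Import all_boot all_order all_algebra.
From mathcomp Require Import reals boolp zify ring lra.

Import Order.TTheory GRing.Theory Num.Theory.
Local Open Scope ring_scope.

(** * Properties of large arguments and signs of polynomials *)

Definition eventually (P : nat -> Prop) : Prop :=
  exists T : nat, forall t, (T <= t)%N -> P t.

Lemma eventuallyW (P : nat -> Prop) : (forall t, P t) -> eventually P.
Proof. by move=> hP; exists 0%N. Qed.

Lemma eventually_mono (P Q : nat -> Prop) :
  (forall t, P t -> Q t) -> eventually P -> eventually Q.
Proof. by move=> PQ [T hT]; exists T => t /hT /PQ. Qed.

Lemma eventually_and (P Q : nat -> Prop) :
  eventually P -> eventually Q -> eventually (fun t => P t /\ Q t).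
Proof.
move=> [T hT] [T' hT']; exists (maxn T T') => t.
by rewrite geq_max => /andP[/hT ? /hT' ?].
Qed.

Lemma eventually_forall (I : finType) (P : I -> nat -> Prop) :
  (forall i, eventually (P i)) -> eventually (fun t => forall i, P i t).
Proof.
move=> /fin_all_exists[T hT]; exists (\max_i T i)%N => t le_t i.
exact: hT (leq_trans (leq_bigmax i) le_t).
Qed.

Lemma eventually_affine (P : nat -> Prop) (N r : nat) :
  (0 < N)%N -> eventually P -> eventually (fun s => P (N * s + r)%N).
Proof.
move=> N0 [T hT]; exists T => s le_s; apply: hT.
by apply: leq_trans le_s _; rewrite -(mul1n s) mulnA muln1; nia.
Qed.

(** For [t >= 1] each lower power satisfies [t ^ i * t <= t ^ d]. Multiplying by [t] instead of
    dividing lets the estimate serve over the integers as well as over the rationals. *)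
Lemma horner_lead_bound (R : numDomainType) (p : {poly R}) (d t : nat) :
  (size p <= d.+1)%N -> (0 < t)%N ->
  `|p.[t%:R] - p`_d * t%:R ^+ d| * t%:R
    <= (\sum_(i < d) `|p`_i|) * t%:R ^+ d.
Proof.
move=> sz t0; rewrite (horner_coef_wide _ sz) big_ord_recr /= addrK.
apply: le_trans (ler_wpM2r _ (ler_norm_sum _ _ _)) _; first exact: ler0n.
rewrite !mulr_suml; apply: ler_sum => i _.
rewrite normrM -mulrA; apply: ler_wpM2l => //.
rewrite normrX normr_nat -exprSr; apply: ler_weXn2l => //.
by rewrite ler1n.
Qed.

Lemma horner_eventually_strict_sign (p : {poly rat}) :
  p != 0 ->
  eventually (fun t => 0 < p.[t%:R]) \/ eventually (fun t => p.[t%:R] < 0).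
Proof.
move=> p0.
set d := (size p).-1.
have sz : size p = d.+1 by rewrite prednK // size_poly_gt0.
have lc0 : p`_d != 0 by rewrite -lead_coefE lead_coef_eq0.
pose K := \sum_(i < d) `|p`_i|.
have key : eventually (fun t => `|p.[t%:R] - p`_d * t%:R ^+ d| < `|p`_d| * t%:R ^+ d).
  have K0 : 0 <= K / `|p`_d| by rewrite divr_ge0 // sumr_ge0.
  exists (Num.bound (K / `|p`_d|)).+1 => t le_t.
  have t0 : (0 < t)%N by apply: leq_ltn_trans le_t.
  have lt_K : K < `|p`_d| * t%:R.
    rewrite mulrC -ltr_pdivrMr ?normr_gt0 //.
    by apply: lt_trans (archi_boundP K0) _; rewrite ltr_nat.
  have t0R : 0 < t%:R :> rat by rewrite ltr0n.
  rewrite -(ltr_pM2r t0R).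
  have le_sz : (size p <= d.+1)%N by rewrite sz.
  apply: le_lt_trans (horner_lead_bound _ _ _ _ le_sz t0) _.
  by rewrite mulrAC ltr_pM2r ?exprn_gt0.
case: (ltgtP 0 p`_d) lc0 => // s _; [left|right];
  apply: eventually_mono key => t.
  by rewrite (gtr0_norm s) ltr_norml => /andP[? ?]; lra.
by rewrite (ltr0_norm s) ltr_norml => /andP[? ?]; lra.
Qed.

Lemma horner_eventually_sign (p : {poly rat}) :
  eventually (fun t => 0 <= p.[t%:R]) \/ eventually (fun t => p.[t%:R] < 0).
Proof.
have [->|/horner_eventually_strict_sign[h|h]] := eqVneq p 0; last by right.
  by left; apply: eventuallyW => t; rewrite horner0.
by left; apply: eventually_mono h => t /ltW.
Qed.

(** * Eventually quasi-polynomial functions *)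

(** The modulus is explicit so that finitely many functions can be brought to a common one. For
    [0 < N], residues [r >= N] are vacuous. *)
Definition eqp_mod (N : nat) (g : nat -> rat) : Prop :=
  forall r : nat, exists p : {poly rat},
    eventually (fun t => (t %% N)%N = r -> g t = p.[t%:R]).

Lemma eqp_modP (g : nat -> rat) :
  eventually_quasi_poly g <-> exists2 N, (0 < N)%N & eqp_mod N g.
Proof.
split=> [[N [p [N0 [T hT]]]]|[N N0 hg]].
  exists N => // r; have [ltrN|leNr] := ltnP r N.
    exists (p (Ordinal ltrN)), T => t le_t tr; apply: hT => //=.
    by rewrite tr modn_small.
  exists 0, 0%N => t _ tr; move: (ltn_pmod t N0); rewrite tr ltnNge leNr //.
have /fin_all_exists[p /eventually_forall[T hT]] :
  forall r : 'I_N, exists p : {poly rat},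
    eventually (fun t => (t %% N)%N = r -> g t = p.[t%:R]) by move=> r; apply: hg.
exists N, p; split=> //; exists T => t le_t i ti; apply: hT => //.
by rewrite ti modn_small.
Qed.

Lemma eqp_mod_mul (N M : nat) (g : nat -> rat) :
  eqp_mod N g -> eqp_mod (N * M) g.
Proof.
move=> hg r; have [p hp] := hg (r %% N)%N; exists p.
apply: eventually_mono hp => t hp tr; apply: hp.
by rewrite -tr modn_dvdm // dvdn_mulr.
Qed.

Lemma eqp_mod_common (I : finType) (g : I -> nat -> rat) :
  (forall i, eventually_quasi_poly (g i)) ->
  exists2 N, (0 < N)%N & forall i, eqp_mod N (g i).
Proof.
move=> hg.
have /fin_all_exists2[N N0 hN] :
  forall i, exists2 N, (0 < N)%N & eqp_mod N (g i) by move=> i; apply/eqp_modP.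
exists (\prod_i N i)%N => [|i]; first by apply: prodn_gt0.
by rewrite (bigD1 i) //=; apply: eqp_mod_mul.
Qed.

Lemma eqp_poly (p : {poly rat}) : eventually_quasi_poly (fun t => p.[t%:R]).
Proof.
by apply/eqp_modP; exists 1%N => // r; exists p; apply: eventuallyW.
Qed.

Lemma eqp_eventually_eq (g g' : nat -> rat) :
  eventually (fun t => g t = g' t) -> eventually_quasi_poly g ->
  eventually_quasi_poly g'.
Proof.
move=> egg' /eqp_modP[N N0 hg]; apply/eqp_modP; exists N => // r.
have [p hp] := hg r; exists p; apply: eventually_mono (eventually_and _ _ egg' hp).
by move=> t [<-].
Qed.

Lemma eqp_op2 (op : rat -> rat -> rat)
    (opp : {poly rat} -> {poly rat} -> {poly rat}) (f g : nat -> rat) :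
  (forall p q x, (opp p q).[x] = op p.[x] q.[x]) ->
  eventually_quasi_poly f -> eventually_quasi_poly g ->
  eventually_quasi_poly (fun t => op (f t) (g t)).
Proof.
move=> opE hf hg.
have [|N N0 hN] := @eqp_mod_common bool (fun b => if b then f else g).
  by case.
apply/eqp_modP; exists N => // r.
have [[p hp] [q hq]] := (hN true r, hN false r).
exists (opp p q); apply: eventually_mono (eventually_and _ _ hp hq).
by move=> t [hpt hqt] tr; rewrite opE (hpt tr) (hqt tr).
Qed.

Lemma eqpD f g : eventually_quasi_poly f -> eventually_quasi_poly g ->
  eventually_quasi_poly (fun t => f t + g t).
Proof. by apply: (@eqp_op2 _ (fun p q => p + q)) => p q x; rewrite hornerD. Qed.

Lemma eqpM f g : eventually_quasi_poly f -> eventually_quasi_poly g ->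
  eventually_quasi_poly (fun t => f t * g t).
Proof. by apply: (@eqp_op2 _ (fun p q => p * q)) => p q x; rewrite hornerM. Qed.

Lemma eqpB f g : eventually_quasi_poly f -> eventually_quasi_poly g ->
  eventually_quasi_poly (fun t => f t - g t).
Proof.
by apply: (@eqp_op2 (fun x y => x - y) (fun p q => p - q)) => p q x;
  rewrite hornerD hornerN.
Qed.

Lemma eqp_sum (I : Type) (s : seq I) (g : I -> nat -> rat) :
  (forall i, eventually_quasi_poly (g i)) ->
  eventually_quasi_poly (fun t => \sum_(i <- s) g i t).
Proof.
move=> hg; elim: s => [|i s IH].
  apply: eqp_eventually_eq (eqp_poly 0); apply: eventuallyW => t.
  by rewrite big_nil horner0.
apply: eqp_eventually_eq (eqpD _ _ (hg i) IH); apply: eventuallyW => t.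
by rewrite big_cons.
Qed.

(** On each class of a common modulus [c] is eventually a polynomial, hence of eventually constant
    sign, so the same branch is taken from some point on. *)
Lemma eqp_if (c f g : nat -> rat) :
  eventually_quasi_poly c -> eventually_quasi_poly f ->
  eventually_quasi_poly g ->
  eventually_quasi_poly (fun t => if 0 <= c t then f t else g t).
Proof.
move=> hc hf hg.
have [|N N0 hN] := @eqp_mod_common (option bool)
    (fun i => if i is Some b then if b then f else g else c).
  by case=> [[]|].
apply/eqp_modP; exists N => // r.
have [[pc hpc] [pf hpf] [pg hpg]] :=
  And3 (hN None r) (hN (Some true) r) (hN (Some false) r).
have [spc|spc] := horner_eventually_sign pc.
  exists pf; apply: eventually_mono
    (eventually_and _ _ spc (eventually_and _ _ hpc hpf)).
  by move=> t [h0 [h1 h2]] tr; rewrite (h1 tr) h0 (h2 tr).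
exists pg; apply: eventually_mono
  (eventually_and _ _ spc (eventually_and _ _ hpc hpg)).
by move=> t [h0 [h1 h2]] tr; rewrite (h1 tr) leNgt h0 (h2 tr).
Qed.

(** The class of [t] modulo [M * N.+1] fixes both the remainder [r] and the class of the quotient
    modulo [M]. A polynomial in the quotient is a polynomial in [t], by substituting
    [(t - r) / N.+1]. *)
Lemma eqp_interleave (N : nat) (g : 'I_N.+1 -> nat -> rat) :
  (forall r, eventually_quasi_poly (g r)) ->
  eventually_quasi_poly (fun t => g (inord (t %% N.+1)) (t %/ N.+1)%N).
Proof.
move=> /eqp_mod_common[M M0 hM]; apply/eqp_modP.
exists (M * N.+1)%N => [|a]; first by rewrite muln_gt0 M0.
set r : 'I_N.+1 := inord (a %% N.+1).
have [p [T hT]] := hM r (a %/ N.+1)%N.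
exists (p \Po (N.+1%:R^-1 *: ('X - (val r)%:R%:P))).
exists (T * N.+1)%N => t le_t ta.
have tr : (t %% N.+1)%N = (a %% N.+1)%N by rewrite -ta modn_dvdm // dvdn_mull.
have rE : (val r) = (t %% N.+1)%N.
  by rewrite tr /r /= inordK // ltn_mod.
rewrite tr -/r hT.
- rewrite horner_comp !hornerE rE {2}(divn_eq t N.+1) natrD addrK natrM.
  by congr horner; rewrite mulrC mulfK // pnatr_eq0.
- by rewrite leq_divRL.
- by rewrite modn_divl ta.
Qed.

(** * Closest vectors in integer lattices *)

Definition in_lattice {n m} (A : 'M[int]_(n, m)) (v : 'rV[int]_m) : Prop :=
  exists c : 'rV[int]_n, v = c *m A.

Definition sqnorm {m} (v : 'rV[int]_m) : int := \sum_j v 0 j ^+ 2.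

(* Closeness to the rational target [h^-1 *: z], with denominators cleared. *)
Definition closest {n m} (A : 'M[int]_(n, m)) (z : 'rV[int]_m) (h : int)
    (u : 'rV[int]_m) : Prop :=
  in_lattice A u /\
  forall v, in_lattice A v -> sqnorm (h *: u - z) <= sqnorm (h *: v - z).

Lemma mxE_scaleB m (a : int) (u v : 'rV[int]_m) j :
  (a *: u - v) 0 j = a * u 0 j - v 0 j.
Proof. by rewrite !mxE. Qed.

Lemma sqnorm_ge0 m (v : 'rV[int]_m) : 0 <= sqnorm v.
Proof. by apply: sumr_ge0 => j _; apply: sqr_ge0. Qed.

Lemma sqnormE m (v : 'rV[int]_m) : sqnorm v = (v *m v^T) 0 0.
Proof. by rewrite mxE; apply: eq_bigr => j _; rewrite mxE expr2. Qed.

Lemma sqnormZ m (a : int) (v : 'rV[int]_m) : sqnorm (a *: v) = a ^+ 2 * sqnorm v.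
Proof. by rewrite mulr_sumr; apply: eq_bigr => j _; rewrite mxE exprMn. Qed.

Lemma sqnorm_entry m (v : 'rV[int]_m) j : v 0 j ^+ 2 <= sqnorm v.
Proof.
by rewrite /sqnorm (bigD1 j) //= lerDl sumr_ge0 // => i _; apply: sqr_ge0.
Qed.

Lemma sqnorm_eq0 m (v : 'rV[int]_m) : sqnorm v = 0 -> v = 0.
Proof.
move=> v0; apply/rowP => j; rewrite mxE; apply/eqP.
by rewrite -(@sqrf_eq0 int) eq_le sqr_ge0 -v0 sqnorm_entry.
Qed.

Lemma sqnormD_orth m (u v : 'rV[int]_m) :
  u *m v^T = 0 -> sqnorm (u + v) = sqnorm u + sqnorm v.
Proof.
move=> uv; have vu : v *m u^T = 0 by rewrite -[LHS]trmxK trmx_mul trmxK uv trmx0.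
by rewrite !sqnormE linearD /= mulmxDl !mulmxDr uv vu addr0 add0r mxE.
Qed.

(** The cleared squared distances are nonnegative integers, so they attain a minimum; independence
    of the rows is not at stake. *)
Lemma closest_exists n m (A : 'M[int]_(n, m)) (z : 'rV[int]_m) (h : int) :
  exists u, closest A z h u.
Proof.
pose P k := `[< exists2 u, in_lattice A u & `|sqnorm (h *: u - z)|%N = k >].
have exP : exists k, P k.
  exists `|sqnorm (h *: (0 : 'rV_m) - z)|%N; apply/asboolP; exists 0 => //.
  by exists 0; rewrite mul0mx.
case: (ex_minnP exP) => k /asboolP[u uA uk] kmin; exists u; split=> // v vA.
have /kmin : P `|sqnorm (h *: v - z)|%N by apply/asboolP; exists v.
by rewrite -uk -lez_nat !gez0_abs ?sqnorm_ge0.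
Qed.

Lemma closest_eq_lattice n n' m (A : 'M[int]_(n, m)) (A' : 'M[int]_(n', m)) z h u :
  (forall v, in_lattice A v <-> in_lattice A' v) ->
  closest A z h u -> closest A' z h u.
Proof.
by move=> AA' [uA umin]; split=> [|v /AA' vA]; [apply/AA' | apply: umin].
Qed.

(* Pythagoras for the orthogonal projection of [h^-1 *: z] onto the row space
   of [A], whose coordinates are [D^-1 *: Y]. *)
Lemma sqnorm_proj n m (A : 'M[int]_(n, m)) (z : 'rV[int]_m) (h : int) c :
  let G := A *m A^T in
  let D : int := h * \det G in let Y := z *m A^T *m \adj G in
  \det G ^+ 2 * sqnorm (h *: (c *m A) - z) =
    sqnorm ((D *: c - Y) *m A) + sqnorm (Y *m A - \det G *: z).
Proof.
move=> G D Y; rewrite -sqnormZ -sqnormD_orth.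
  congr sqnorm; rewrite mulmxBl addrA subrK scalerBr -scalemxAl scalerA.
  by rewrite [\det G * h]mulrC.
have orth : (Y *m A - \det G *: z) *m A^T = 0.
  rewrite mulmxBl -scalemxAl -(mulmxA Y) -/G -(mulmxA _ (\adj G)) mul_adj_mx.
  by rewrite mul_mx_scalar subrr.
by rewrite -mulmxA -[A *m _]trmxK trmx_mul trmxK orth trmx0 mulmx0.
Qed.

(** A vector [v] killed by the Gram matrix satisfies [sqnorm (v *m A) = 0], since this is the value
    of the Gram form at [v]. *)
Lemma gram_det_neq0 n m (A : 'M[int]_(n, m)) :
  (forall v : 'rV[int]_n, v *m A = 0 -> v = 0) -> \det (A *m A^T) != 0.
Proof.
move=> kerA; apply/negP => /det0P[v /eqP v0 vG]; apply/v0/kerA/sqnorm_eq0.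
rewrite sqnormE trmx_mul -mulmxA [A *m (_ *m _)]mulmxA.
by rewrite mulmxA vG mul0mx mxE.
Qed.

(** By Pythagoras, a closest vector is no farther from the projection of the target than the vector
    obtained by rounding the coordinates of that projection. The rounding error is at most of the
    order of the largest row size [w k], and almost orthogonality turns this into a bound on the
    coordinate [k], from which [w k] cancels. *)
Lemma closest_coef_bound n m (A : 'M[int]_(n, m)) (z : 'rV[int]_m) (h K : int)
    (w : 'I_n -> int) (k : 'I_n) (c : 'rV[int]_n) :
  h != 0 -> 0 <= K -> (forall i, 0 < w i) -> (forall i, w i <= w k) ->
  (forall i j, `|A i j| <= K * w i) ->
  (forall (e : 'rV[int]_n) (M : int), 0 <= M ->
     (forall j, `|(e *m A) 0 j| <= M) ->
     forall i, `|e 0 i| * w i <= K * M) ->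
  closest A z h (c *m A) ->
  let G := A *m A^T in
  let D : int := h * \det G in let Y := z *m A^T *m \adj G in
  D != 0 /\ `|D * c 0 k - Y 0 k| <= K * K * m%:R * n%:R * `|D|.
Proof.
move=> h0 K0 w0 wk Aub Alb [_ cmin] G D Y.
have det0 : \det G != 0.
  apply: gram_det_neq0 => v vA; apply/rowP => i; rewrite mxE; apply/eqP.
  have H : `|v 0 i| * w i <= K * 0.
    by apply: Alb => // j; rewrite vA mxE normr0.
  by move: H; rewrite mulr0 pmulr_lle0 // normr_le0.
have D0 : D != 0 by rewrite mulf_neq0.
split=> //.
(* The coordinates of the projection, rounded by Euclidean division: each remainder is smaller than
   [D] in absolute value. *)
pose c' : 'rV[int]_n := \row_i divz (Y 0 i) D.
have le_sq : sqnorm ((D *: c - Y) *m A) <= sqnorm ((D *: c' - Y) *m A).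
  rewrite -(lerD2r (sqnorm (Y *m A - \det G *: z))) -!sqnorm_proj.
  apply: ler_wpM2l; first exact: sqr_ge0.
  by apply: cmin; exists c'.
have rem_entry j : `|((D *: c' - Y) *m A) 0 j| <= K * n%:R * w k * `|D|.
  rewrite mxE; apply: le_trans (ler_norm_sum _ _ _) _.
  apply: le_trans (ler_sum _ (G := fun=> K * w k * `|D|) _) _; last first.
    rewrite sumr_const card_ord -mulr_natr le_eqVlt; apply/orP; left; apply/eqP; ring.
  move=> i _; rewrite normrM mxE_scaleB [c' 0 i]mxE [leRHS]mulrC.
  apply: ler_pM => //; last first.
    by apply: le_trans (Aub i j) _; apply: ler_wpM2l.
  rewrite distrC {1}(divz_eq (Y 0 i) D) [D * _]mulrC addrAC subrr add0r.
  by rewrite ger0_norm ?modz_ge0 // ltW // ltz_mod.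
have M0 : 0 <= K * n%:R * w k * `|D| by rewrite !mulr_ge0 // ltW.
have mM0 : 0 <= m%:R * (K * n%:R * w k * `|D|) by rewrite mulr_ge0.
(* Going from entries to the Euclidean norm and back costs a factor [sqrt m], bounded here by
   [m]. *)
have lhs_entry j : `|((D *: c - Y) *m A) 0 j| <= m%:R * (K * n%:R * w k * `|D|).
  rewrite -(@ler_sqr int) ?nnegrE //.
  rewrite real_normK ?num_real //.
  apply: le_trans (sqnorm_entry _ _ _) (le_trans le_sq _).
  apply: le_trans (ler_sum _ (G := fun=> (K * n%:R * w k * `|D|) ^+ 2) _) _.
    move=> i _; rewrite -real_normK ?num_real //.
    by rewrite (@ler_sqr int) ?nnegrE.
  rewrite sumr_const card_ord -[leLHS]mulr_natl [leRHS]exprMn; apply: ler_wpM2r.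
    exact: sqr_ge0.
  by rewrite -natrX ler_nat; nia.
have := Alb _ _ mM0 lhs_entry k; rewrite mxE_scaleB => le_k.
rewrite -(ler_pM2r (w0 k)); apply: le_trans le_k _.
rewrite le_eqVlt; apply/orP; left; apply/eqP; ring.
Qed.

(** Fixing the coefficient of row [k] leaves a problem for the other rows with a translated
    target. *)
Lemma in_latticeD1 n m (A : 'M[int]_(n.+1, m)) (k : 'I_n.+1) (v : 'rV[int]_m) :
  in_lattice A v <->
  exists2 c : 'rV[int]_n.+1, v = c *m A &
    in_lattice (row' k A) (v - c 0 k *: row k A).
Proof.
split=> [[c ->]|[c -> _]]; last by exists c.
exists c => //; exists (col' k c); rewrite !mulmx_sum_row (bigD1_ord k) //=.
rewrite addrAC subrr add0r; apply: eq_bigr => i _.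
by rewrite mxE; congr (_ *: _); apply/rowP => j; rewrite !mxE.
Qed.

Lemma in_lattice_row'D n m (A : 'M[int]_(n.+1, m)) (k : 'I_n.+1)
    (v : 'rV[int]_m) (x : int) :
  in_lattice (row' k A) v -> in_lattice A (v + x *: row k A).
Proof.
move=> [c ->]; exists (\row_i if unlift k i is Some i' then c 0 i' else x).
rewrite !mulmx_sum_row (bigD1_ord k) //= mxE unlift_none addrC; congr (_ + _).
apply: eq_bigr => i _; rewrite mxE liftK; congr (_ *: _).
by apply/rowP => j; rewrite !mxE.
Qed.

(** * Parametric lattices *)

Definition mx_at {n m} (t : nat) (B : 'M[{poly int}]_(n, m)) : 'M[int]_(n, m) :=
  map_mx (horner_eval t%:R) B.

Definition affine (N r : nat) : {poly int} := N%:R *: 'X + r%:R%:P.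

Definition mx_affine {n m} (N r : nat) (B : 'M[{poly int}]_(n, m)) :=
  map_mx (fun p => p \Po affine N r) B.

Lemma horner_affine (N r s : nat) (p : {poly int}) :
  (p \Po affine N r).[s%:R] = p.[(N * s + r)%:R].
Proof. by rewrite horner_comp /affine !hornerE natrD natrM. Qed.

Lemma mx_at_affine n m (N r s : nat) (B : 'M[{poly int}]_(n, m)) :
  mx_at s (mx_affine N r B) = mx_at (N * s + r) B.
Proof. by apply/matrixP => i j; rewrite !mxE /horner_eval horner_affine. Qed.

Lemma horner_intr (p : {poly int}) (t : nat) :
  (p.[t%:R])%:~R = (map_poly intr p).[t%:R] :> rat.
Proof. by rewrite -(horner_map _ p) /= rmorph_nat. Qed.

Lemma horner_eventually_neq0 (p : {poly int}) :
  p != 0 -> eventually (fun t => p.[t%:R] != 0).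
Proof.
move=> p0; have : map_poly intr p != 0 :> {poly rat}.
  by rewrite map_poly_eq0_id0 // intr_eq0 lead_coef_eq0.
move=> /horner_eventually_strict_sign[] h; apply: eventually_mono h => t;
  rewrite -horner_intr ?ltr0z ?ltrz0; [exact: lt0r_neq0 | exact: ltr0_neq0].
Qed.

Definition eqp_rV {m} (u : nat -> 'rV[int]_m) : Prop :=
  forall j, eventually_quasi_poly (fun t => (u t 0 j)%:~R).

Lemma eqp_intr (p : {poly int}) :
  eventually_quasi_poly (fun t => (p.[t%:R])%:~R).
Proof.
apply: eqp_eventually_eq (eqp_poly (map_poly intr p)).
by apply: eventuallyW => t; rewrite horner_intr.
Qed.

Lemma eqp_rV_mx_at m (v : 'rV[{poly int}]_m) : eqp_rV (mx_at^~ v).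
Proof.
move=> j; apply: eqp_eventually_eq (eqp_intr (v 0 j)).
by apply: eventuallyW => t; rewrite mxE.
Qed.

Lemma eqp_rVD m (u v : nat -> 'rV[int]_m) :
  eqp_rV u -> eqp_rV v -> eqp_rV (fun t => u t + v t).
Proof.
move=> hu hv j; apply: eqp_eventually_eq (eqpD _ _ (hu j) (hv j)).
by apply: eventuallyW => t; rewrite mxE rmorphD.
Qed.

Lemma eqp_sqnorm m (u : nat -> 'rV[int]_m) (z : 'rV[{poly int}]_m)
    (h : {poly int}) :
  eqp_rV u ->
  eventually_quasi_poly (fun t => (sqnorm (h.[t%:R] *: u t - mx_at t z))%:~R).
Proof.
move=> hu.
have hj j : eventually_quasi_poly
    (fun t => (h.[t%:R])%:~R * (u t 0 j)%:~R - ((z 0 j).[t%:R])%:~R).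
  by apply: eqpB (eqp_intr _); apply: eqpM (eqp_intr _) _.
apply: eqp_eventually_eq
  (eqp_sum _ (index_enum 'I_m) _ (fun j => eqpM _ _ (hj j) (hj j))).
apply: eventuallyW => t; rewrite rmorph_sum; apply: eq_bigr => j _.
by rewrite mxE_scaleB mxE expr2 /= rmorphM rmorphB rmorphM.
Qed.

(** The costs are themselves eventually quasi-polynomial, so [eqp_if] can compare them one candidate
    at a time. The minimum is exact at every [t]; only its description is asymptotic. *)
Lemma eqp_argmin m (K : nat) (v : nat -> nat -> 'rV[int]_m)
    (z : 'rV[{poly int}]_m) (h : {poly int}) :
  (forall j, eqp_rV (v j)) ->
  exists2 u, eqp_rV u & forall t,
    (exists2 j, (j <= K)%N & u t = v j t) /\
    forall j, (j <= K)%N ->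
      sqnorm (h.[t%:R] *: u t - mx_at t z)
        <= sqnorm (h.[t%:R] *: v j t - mx_at t z).
Proof.
move=> hv; pose cost t w := sqnorm (h.[t%:R] *: w - mx_at t z).
elim: K => [|K [u hu umin]].
  exists (v 0%N) => // t; split; first by exists 0%N.
  by move=> j; rewrite leqn0 => /eqP->.
exists (fun t => if cost t (u t) <= cost t (v K.+1 t) then u t else v K.+1 t).
  move=> j; apply: eqp_eventually_eq (eqp_if _ _ _
    (eqpB _ _ (eqp_sqnorm _ _ z h (hv K.+1)) (eqp_sqnorm _ _ z h hu)) (hu j)
    (hv K.+1 j)).
  apply: eventuallyW => t; rewrite subr_ge0 ler_int -!/(cost _ _).
  by case: ifP.
move=> t; have [[i le_i ui] le_u] := umin t.
case: ifPn => [le_c|]; rewrite -?ltNge.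
  split; first by exists i => //; apply: leqW.
  by move=> j; rewrite leq_eqVlt => /predU1P[->//|/le_u].
move=> lt_c; split; first by exists K.+1.
move=> j; rewrite leq_eqVlt => /predU1P[->//|/le_u].
by apply: le_trans; apply: ltW.
Qed.

(** * Closest vector problems with polynomial data *)

Definition cvp {n m} (B : 'M[{poly int}]_(n, m)) (z : 'rV[{poly int}]_m)
    (h : {poly int}) : Prop :=
  exists2 u : nat -> 'rV[int]_m, eqp_rV u &
    eventually (fun t => closest (mx_at t B) (mx_at t z) h.[t%:R] (u t)).

Lemma cvp_affine n m (B : 'M[{poly int}]_(n, m)) z h (N : nat) :
  (0 < N)%N ->
  (forall r, cvp (mx_affine N r B) (mx_affine N r z) (h \Po affine N r)) ->
  cvp B z h.
Proof.
case: N => // N _ hr.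
have /fin_all_exists2[u hu /eventually_forall[T hT]] :
  forall r : 'I_N.+1, exists2 u : nat -> 'rV[int]_m, eqp_rV u &
    eventually (fun s => closest (mx_at (N.+1 * s + r) B)
      (mx_at (N.+1 * s + r) z) h.[(N.+1 * s + r)%:R] (u s)).
  move=> r; have [u hu hc] := hr r; exists u => //.
  by apply: eventually_mono hc => s; rewrite !mx_at_affine horner_affine.
exists (fun t => u (inord (t %% N.+1)) (t %/ N.+1)%N).
  by move=> j; apply: (eqp_interleave _ (fun r t => (u r t 0 j)%:~R)) => r; apply: hu.
exists (T * N.+1)%N => t le_t.
have := hT (t %/ N.+1)%N _ (inord (t %% N.+1)).
rewrite inordK ?ltn_mod // mulnC -divn_eq; apply.
by rewrite leq_divRL.
Qed.

Lemma cvp_eq_lattice n n' m (B : 'M[{poly int}]_(n, m))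
    (B' : 'M[{poly int}]_(n', m)) z h :
  (forall t v, in_lattice (mx_at t B) v <-> in_lattice (mx_at t B') v) ->
  cvp B z h -> cvp B' z h.
Proof.
move=> BB' [u hu hc]; exists u => //; apply: eventually_mono hc => t.
exact: closest_eq_lattice (BB' t).
Qed.

(* The rows of [B] are almost orthogonal: up to the constant [K], the sup-norm
   of a combination is the largest of the sup-norms of its terms, the [i]-th
   row having size [tau ^+ d i]. *)
Definition reduced {n m} (B : 'M[{poly int}]_(n, m)) : Prop :=
  exists (K : int) (d : 'I_n -> nat) (tau : nat -> int),
    0 <= K /\ eventually (fun t =>
      [/\ 1 <= tau t,
          forall i j, `|mx_at t B i j| <= K * tau t ^+ d i &
          forall (e : 'rV[int]_n) (M : int), 0 <= M ->
            (forall j, `|(e *m mx_at t B) 0 j| <= M) ->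
            forall i, `|e 0 i| * tau t ^+ d i <= K * M]).

Lemma reduced_affine n m (B : 'M[{poly int}]_(n, m)) (N r : nat) :
  (0 < N)%N -> reduced B -> reduced (mx_affine N r B).
Proof.
move=> N0 [K [d [tau [K0 /(eventually_affine _ _ r N0) hB]]]].
exists K, d, (fun s => tau (N * s + r)%N); split=> //.
by apply: eventually_mono hB => s; rewrite mx_at_affine.
Qed.

Lemma reduced_row' n m (B : 'M[{poly int}]_(n.+1, m)) (k : 'I_n.+1) :
  reduced B -> reduced (row' k B).
Proof.
move=> [K [d [tau [K0 hB]]]].
exists K, (fun i => d (lift k i)), tau; split=> //.
apply: eventually_mono hB => t [tau1 Bub Blb]; split=> // [i j|e M M0 eM i].
  by have := Bub (lift k i) j; rewrite !mxE.
pose e' : 'rV[int]_n.+1 := \row_i if unlift k i is Some i' then e 0 i' else 0.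
have := Blb e' M M0 _ (lift k i); rewrite mxE liftK; apply => j.
have -> : e' *m mx_at t B = e *m mx_at t (row' k B).
  rewrite !mulmx_sum_row (bigD1_ord k) //= mxE unlift_none scale0r add0r.
  apply: eq_bigr => i' _; rewrite mxE liftK; congr (_ *: _).
  by apply/rowP => j'; rewrite !mxE.
exact: eM.
Qed.

(** Pseudo-division keeps the coefficients integral at the price of the factor [a], a power of the
    leading coefficient of [D]. The remainder has smaller degree than [D], hence is eventually
    dominated by it. *)
Lemma pseudo_quotient (Y D : {poly int}) :
  D != 0 -> exists (a : int) (Q : {poly int}), a != 0 /\
    eventually (fun t => `|a * Y.[t%:R] - Q.[t%:R] * D.[t%:R]| <= `|D.[t%:R]|).
Proof.
move=> D0; exists (lead_coef D ^+ scalp Y D), (Y %/ D).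
split; first by rewrite expf_neq0 // lead_coef_eq0.
set Rm := Y %% D.
have szD : size D = (size D).-1.+1 by rewrite prednK // size_poly_gt0.
have szRm : (size Rm < size D)%N by rewrite ltn_modp.
set d := (size D).-1 in szD.
have Rmd : Rm`_d = 0 by rewrite nth_default // -ltnS -szD.
pose KD : int := \sum_(i < d) `|D`_i|; pose KR : int := \sum_(i < d) `|Rm`_i|.
(* Since the leading coefficient of [D] is at least 1 in absolute value, such a [t] makes the
   leading term exceed the lower terms of [D] and the remainder together. *)
exists (`|KD| + `|KR|).+1%N => t le_t.
have -> : lead_coef D ^+ scalp Y D * Y.[t%:R] - (Y %/ D).[t%:R] * D.[t%:R]
    = Rm.[t%:R].
  rewrite -hornerZ Pdiv.Idomain.divp_eq hornerD hornerM addrAC subrr.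
  by rewrite add0r.
have t0 : (0 < t)%N by apply: leq_ltn_trans le_t.
have szD' : (size D <= d.+1)%N by rewrite szD.
have szR' : (size Rm <= d.+1)%N by rewrite -szD ltnW.
have := horner_lead_bound _ _ _ _ szD' t0.
have := horner_lead_bound _ _ _ _ szR' t0.
rewrite Rmd mul0r subr0 -/KD -/KR => hR hD.
have t0Z : 0 < t%:R :> int by rewrite ltr0n.
have td : 0 < t%:R ^+ d :> int by rewrite exprn_gt0.
have lcD : 1 <= `|D`_d|.
  by rewrite -gtz0_ge1 normr_gt0 -[D`_d]/(lead_coef D) lead_coef_eq0.
rewrite -(ler_pM2r t0Z); apply: le_trans hR _.
have h1 : `|D`_d * t%:R ^+ d| * t%:R <=
    `|D.[t%:R]| * t%:R + `|D.[t%:R] - D`_d * t%:R ^+ d| * t%:R.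
  rewrite -mulrDl ler_wpM2r ?ler0n //.
  have := ler_normB D.[t%:R] (D.[t%:R] - D`_d * t%:R ^+ d).
  by rewrite opprB addrC subrK.
have h2 : (KD + KR) * t%:R ^+ d <= `|D`_d * t%:R ^+ d| * t%:R.
  rewrite normrM (ger0_norm (ltW td)) mulrAC ler_wpM2r ?(ltW td) //.
  apply: le_trans (_ : t%:R <= _); last by rewrite ler_peMl ?ler0n.
  by lia.
rewrite mulrDl in h2.
have := le_trans h2 (le_trans h1 (lerD (lexx _) hD)).
by rewrite [leRHS]addrC lerD2l.
Qed.

(** In the expansion of [Q] at [N s + r] every positive power of [s] comes with a factor [N], so [Q]
    is constant modulo [N] along the progression. *)
Lemma comp_affine_mod (Q : {poly int}) (N r : nat) :
  exists (w : int) (W : {poly int}), Q \Po affine N r = w%:P + N%:R *: W.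
Proof.
elim/poly_ind: Q => [|Q c [w [W IH]]].
  by exists 0, 0; rewrite comp_poly0 scaler0 addr0.
exists (w * r%:R + c), (w *: 'X + W * affine N r).
rewrite comp_polyD comp_polyM comp_polyX comp_polyC IH /affine.
rewrite polyCD polyCM -!mul_polyC; ring.
Qed.

Lemma mx_at_proj n m (B : 'M[{poly int}]_(n, m)) (z : 'rV[{poly int}]_m) t k :
  let A := mx_at t B in
  \det (A *m A^T) = (\det (B *m B^T)).[t%:R] /\
  (mx_at t z *m A^T *m \adj (A *m A^T)) 0 k
    = ((z *m B^T *m \adj (B *m B^T)) 0 k).[t%:R].
Proof.
rewrite /= /mx_at map_trmx -!map_mxM -map_mx_adj -map_mxM det_map_mx.
by split=> //; rewrite mxE.
Qed.

(* For a row [k] of maximal size, the [k]-th coordinate of a closest vector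
   differs from that of the projection of the target, hence from its polynomial
   part, by a bounded amount. *)
Lemma reduced_coef_window n m (B : 'M[{poly int}]_(n.+1, m)) z (h : {poly int}) :
  reduced B -> eventually (fun t => h.[t%:R] != 0) ->
  exists (k : 'I_n.+1) (N : nat), (0 < N)%N /\
    forall r, exists (J : nat) (W : {poly int}), eventually (fun s =>
      forall c : 'rV[int]_n.+1,
        let t := (N * s + r)%N in
        closest (mx_at t B) (mx_at t z) h.[t%:R] (c *m mx_at t B) ->
        `|c 0 k - W.[s%:R]| <= J%:R).
Proof.
move=> [K [d [tau [K0 hB]]]] hh.
pose k := [arg max_(i > ord0 : 'I_n.+1) d i].
have dk i : (d i <= d k)%N by rewrite /k; case: arg_maxnP => // j _; apply.
pose D : {poly int} := h * \det (B *m B^T).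
pose Y : {poly int} := (z *m B^T *m \adj (B *m B^T)) 0 k.
pose C : int := K * K * m%:R * n.+1%:R.
have hC : eventually (fun t => D.[t%:R] != 0 /\ forall c : 'rV[int]_n.+1,
    closest (mx_at t B) (mx_at t z) h.[t%:R] (c *m mx_at t B) ->
    `|D.[t%:R] * c 0 k - Y.[t%:R]| <= C * `|D.[t%:R]|).
  apply: eventually_mono (eventually_and _ _ hB hh) => t [[tau1 Bub Blb] ht].
  have [detE YE] := mx_at_proj _ _ B z t k.
  have key c : closest (mx_at t B) (mx_at t z) h.[t%:R] (c *m mx_at t B) ->
      D.[t%:R] != 0 /\ `|D.[t%:R] * c 0 k - Y.[t%:R]| <= C * `|D.[t%:R]|.
    move=> hc.
    have := @closest_coef_bound _ _ (mx_at t B) (mx_at t z) h.[t%:R] K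
      (fun i => tau t ^+ d i) k c ht K0 _ _ Bub Blb hc.
    rewrite /= detE YE /D hornerM; apply=> i; last exact: ler_weXn2l.
    by rewrite exprn_gt0 // (lt_le_trans _ tau1).
  split; last by move=> c /key[].
  (* The nonvanishing of [D] is a by-product of the coefficient bound, so it is read off from any
     closest vector. *)
  have [u hu] := closest_exists _ _ (mx_at t B) (mx_at t z) h.[t%:R].
  by have [[c uc] _] := hu; rewrite uc in hu; have [] := key c hu.
have D0 : D != 0.
  by have [T /(_ T (leqnn T)) [+ _]] := hC; apply: contra_neq => ->; rewrite horner0.
have [a [Q [a0 hQ]]] := pseudo_quotient Y D D0.
have N0 : (0 < `|a|)%N by rewrite absz_gt0.
exists k, `|a|%N; split=> // r.
(* Modulo [a] the polynomial [Q] is constant on this progression, so [Q / a] is the integer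
   polynomial [W] plus a constant. The factor [sgz a] accounts for the modulus being the absolute
   value of [a]. *)
have [w [W QE]] := comp_affine_mod (sgz a *: Q) `|a|%N r.
(* The three terms come from the distance to the projection, the pseudo-division and the constant
   [w]. *)
exists (absz (C + 1 + `|w|)), W.
apply: eventually_mono
  (eventually_affine _ _ r N0 (eventually_and _ _ hC hQ)) => s.
set t := (_ * s + r)%N => -[[Dt hCt] hQt] c /= /hCt{hCt}.
have {}QE : sgz a * Q.[t%:R] = w + `|a|%N%:R * W.[s%:R].
  by rewrite -(hornerZ _ Q) /t -horner_affine QE !hornerE.
move: hQt; set q := Q.[_]; set y := Y.[_]; set dd := D.[_]; set x := c 0 k.
rewrite -/dd in Dt; rewrite -/q in QE; set W0 := W.[_] in QE *.
move=> hQt hCt.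
have h1 : `|a * x - q| * `|dd| <= (`|a| * C + 1) * `|dd|.
  rewrite -normrM [leRHS]mulrDl mul1r -(mulrA `|a| C).
  have -> : (a * x - q) * dd = a * (dd * x - y) + (a * y - q * dd) by ring.
  apply: le_trans (ler_normD _ _) (lerD _ hQt).
  by rewrite normrM ler_wpM2l.
have {}h1 : `|a * x - q| <= `|a| * C + 1 by rewrite -(ler_pM2r (_ : 0 < `|dd|)) ?normr_gt0.
have C0 : 0 <= C by rewrite !mulr_ge0.
have h2 : `|a| * `|x - W0| <= `|a| * C + 1 + `|w|.
  rewrite -[`|a| in leLHS]normr_id -normrM.
  have -> : `|a| * (x - W0) = sgz a * (a * x - q) + w.
    have -> : sgz a * (a * x - q) = (sgz a * a) * x - sgz a * q by ring.
    have -> : sgz a * a = `|a| by rewrite -abszE; lia.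
    by rewrite QE natz abszE; ring.
  apply: le_trans (ler_normD _ _) _; rewrite lerD2r normrM.
  have -> : `|sgz a| = 1 by lia.
  by rewrite mul1r.
have a1 : 1 <= `|a| by lia.
have h3 : `|x - W0| <= C + 1 + `|w|.
  rewrite -(ler_pM2l (_ : 0 < `|a|)); last by lia.
  apply: le_trans h2 _; rewrite !mulrDr -!addrA lerD2l mulr1.
  by rewrite lerD // ler_peMl.
apply: le_trans h3 _; lia.
Qed.

(** Induction on the number of rows: each of the finitely many possible coefficients of row [k]
    gives a problem with one row less, and the best of their solutions is kept. *)
Lemma reduced_cvp n m (B : 'M[{poly int}]_(n, m)) z (h : {poly int}) :
  reduced B -> eventually (fun t => h.[t%:R] != 0) -> cvp B z h.
Proof.
elim: n => [|n IH] in B z h *.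
  move=> _ _; exists (mx_at^~ 0); first exact: eqp_rV_mx_at.
  apply: eventuallyW => t; have at0 : mx_at t (0 : 'rV_m) = 0.
    by apply/rowP => j; rewrite !mxE /horner_eval horner0.
  have lat0 v : in_lattice (mx_at t B) v -> v = 0.
    by move=> [c ->]; rewrite mulmx_sum_row big_ord0.
  split=> [|v /lat0->]; last by rewrite at0.
  by exists 0; rewrite at0 mul0mx.
move=> redB hh.
have [k [N [N0 win]]] := reduced_coef_window _ _ B z h redB hh.
apply: (cvp_affine _ _ _ _ _ N N0) => r.
have [J [W hW]] := win r.
pose B' := mx_affine N r B; pose z' := mx_affine N r z; pose h' := h \Po affine N r.
(* For [j] from 0 to [2 J] these run through the whole window from [W - J] to [W + J]. *)
pose V j : {poly int} := W + (j%:R - J%:R)%:P.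
have hz j : cvp (row' k B') (z' - (h' * V j) *: row k B') h'.
  apply: IH; first by apply: reduced_row'; apply: reduced_affine.
  apply: eventually_mono (eventually_affine _ _ r N0 hh) => s.
  by rewrite horner_affine.
have {}hz j : exists v : nat -> 'rV[int]_m, eqp_rV v /\
    eventually (fun s => closest (mx_at s (row' k B'))
      (mx_at s (z' - (h' * V j) *: row k B')) h'.[s%:R] (v s)).
  by have [v] := hz j; exists v.
have [v hv] := choice hz.
pose cand j s := v j s + mx_at s (V j *: row k B').
have candE j s : h'.[s%:R] *: cand j s - mx_at s z' =
    h'.[s%:R] *: v j s - mx_at s (z' - (h' * V j) *: row k B').
  apply/rowP => i; rewrite !mxE /horner_eval !hornerE; ring.
have rowE j s : mx_at s (V j *: row k B') = (V j).[s%:R] *: row k (mx_at s B').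
  by apply/rowP => i; rewrite !mxE /horner_eval !hornerE.
have [|u hu umin] := eqp_argmin _ J.*2 cand z' h'.
  by move=> j; apply: eqp_rVD (eqp_rV_mx_at _ _); have [] := hv j.
exists u => //.
have hvall : eventually (fun s => forall j : 'I_J.*2.+1,
    closest (mx_at s (row' k B')) (mx_at s (z' - (h' * V j) *: row k B'))
      h'.[s%:R] (v j s)).
  by apply: eventually_forall => j; have [] := hv j.
have row'E s : mx_at s (row' k B') = row' k (mx_at s B').
  by apply/matrixP => i j; rewrite !mxE.
apply: eventually_mono (eventually_and _ _ hW hvall) => s [hWs hvs].
have [[j0 le_j0 uj0] le_u] := umin s.
split=> [|x xB].
  rewrite uj0 /cand rowE; apply: in_lattice_row'D.
  by have := hvs (Ordinal (le_j0 : (j0 < J.*2.+1)%N)) => -[/= + _]; rewrite row'E.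
(* The coefficient of [y] at row [k] lies in the window, so it equals some [V j]; the candidate of
   that index is at least as close as [y]. *)
have [y hy] := closest_exists _ _ (mx_at s B') (mx_at s z') h'.[s%:R].
apply: le_trans (hy.2 x xB).
have /(in_latticeD1 _ _ _ k)[c yc yk] := hy.1.
have le_c : `|c 0 k - W.[s%:R]| <= J%:R.
  by apply: hWs => /=; rewrite -!mx_at_affine -horner_affine -yc.
pose j := absz (c 0 k - W.[s%:R] + J%:R).
have le_j : (j <= J.*2)%N by rewrite /j; lia.
have jE : (V j).[s%:R] = c 0 k.
  by rewrite /V hornerD hornerC /j; lia.
apply: le_trans (le_u _ le_j) _; rewrite candE.
have [_ /(_ (y - c 0 k *: row k (mx_at s B')))] :=
  hvs (Ordinal (le_j : (j < J.*2.+1)%N)).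
rewrite row'E => /(_ yk)/le_trans; apply.
rewrite le_eqVlt; apply/orP; left; apply/eqP; congr sqnorm.
have := rowE j s; rewrite jE => <-.
by apply/rowP => i; rewrite !mxE /horner_eval !hornerE; ring.
Qed.

(** * Degree reduction *)

(* [d i] is only an upper bound for the degree of the [i]-th row of [B], so rows
   of [lead_mx d B] may vanish. *)
Definition lead_mx {n m} (d : 'I_n -> nat) (B : 'M[{poly int}]_(n, m)) :
    'M[int]_(n, m) := \matrix_(i, j) (B i j)`_(d i).

(** With [w i = e i * t ^ d i], the combination [e *m B] at [t] is [w *m L] up to an error of order
    [1 / t] relative to [w]. As [L] has the right inverse [R] up to the nonzero factor [det G], [w]
    is controlled by the combination once [t] is large. *)
Lemma lead_free_reduced n m (d : 'I_n -> nat) (B : 'M[{poly int}]_(n, m)) :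
  (forall i j, (size (B i j) <= (d i).+1)%N) ->
  (forall a : 'rV[int]_n, a *m lead_mx d B = 0 -> a = 0) -> reduced B.
Proof.
move=> szB kerL; set L := lead_mx d B in kerL.
pose G := L *m L^T; pose R := L^T *m \adj G.
have G0 : \det G != 0 by apply: gram_det_neq0.
have LR : L *m R = (\det G)%:M by rewrite mulmxA mul_mx_adj.
pose E : int := \sum_i \sum_j \sum_(l < d i) `|(B i j)`_l|.
pose rho : int := \sum_j \sum_i `|R j i|.
pose U : int := \sum_i \sum_j `|L i j|.
have E0 : 0 <= E by do 3!(apply: sumr_ge0 => ? _).
have rho0 : 0 <= rho by do 2!(apply: sumr_ge0 => ? _).
have U0 : 0 <= U by do 2!(apply: sumr_ge0 => ? _).
have leE i j : \sum_(l < d i) `|(B i j)`_l| <= E.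
  rewrite /E (bigD1 i) //= (bigD1 j) //= -addrA lerDl.
  by apply: addr_ge0; [|apply: sumr_ge0 => ? _];
     apply: sumr_ge0 => ? _; apply: sumr_ge0.
have leU i j : `|L i j| <= U.
  rewrite /U (bigD1 i) //= (bigD1 j) //= -addrA lerDl.
  by apply: addr_ge0; [|apply: sumr_ge0 => ? _]; apply: sumr_ge0.
pose K := 2 * n%:R * rho + E + U.
exists K, d, (fun t => t%:R); split; first by rewrite /K !addr_ge0 // !mulr_ge0.
(* From here on the error contributes at most half of [W], whence the factor 2 in [K]. *)
exists (absz (2 * n%:R * rho * E)).+1 => t le_t.
have t0 : (0 < t)%N by apply: leq_ltn_trans le_t.
have t0Z : 0 < t%:R :> int by rewrite ltr0n.
have t1Z : 1 <= t%:R :> int by rewrite ler1n.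
have td i : 0 < t%:R ^+ d i :> int by rewrite exprn_gt0.
pose err i j := mx_at t B i j - L i j * t%:R ^+ d i.
have errP i j : `|err i j| * t%:R <= E * t%:R ^+ d i.
  rewrite /err !mxE; apply: le_trans (horner_lead_bound _ _ _ _ (szB i j) t0) _.
  by rewrite ler_wpM2r ?(ltW (td i)).
split=> // [i j|e M M0 eM i].
  have -> : mx_at t B i j = err i j + L i j * t%:R ^+ d i by rewrite subrK.
  apply: le_trans (ler_normD _ _) _.
  apply: le_trans (_ : (E + U) * t%:R ^+ d i <= _); last first.
    by rewrite ler_wpM2r ?(ltW (td i)) // /K -addrA lerDr !mulr_ge0.
  rewrite mulrDl lerD //; last first.
    by rewrite normrM (ger0_norm (ltW (td i))) ler_wpM2r ?(ltW (td i)).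
  by apply: le_trans (errP i j); rewrite ler_peMr.
pose w : 'rV[int]_n := \row_i (e 0 i * t%:R ^+ d i).
pose W := \sum_i `|w 0 i|.
have W0 : 0 <= W by apply: sumr_ge0.
have wi i' : `|w 0 i'| = `|e 0 i'| * t%:R ^+ d i'.
  by rewrite mxE normrM (ger0_norm (ltW (td i'))).
have wL j : `|(w *m L) 0 j| * t%:R <= M * t%:R + E * W.
  have -> : (w *m L) 0 j = (e *m mx_at t B) 0 j - \sum_i' e 0 i' * err i' j.
    rewrite !mxE -sumrB; apply: eq_bigr => i' _.
    by rewrite /err [w 0 i']mxE; ring.
  apply: le_trans (ler_wpM2r (ltW t0Z) (ler_normB _ _)) _.
  rewrite mulrDl lerD ?ler_wpM2r ?(ltW t0Z) //.
  apply: le_trans (ler_wpM2r (ltW t0Z) (ler_norm_sum _ _ _)) _.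
  rewrite mulr_suml /W mulr_sumr; apply: ler_sum => i' _.
  rewrite normrM -mulrA wi [leRHS]mulrCA; exact: ler_wpM2l (errP _ _).
have wt i' : `|w 0 i'| * t%:R <= rho * (M * t%:R + E * W).
  have wE : w *m L *m R = \det G *: w by rewrite -mulmxA LR mul_mx_scalar.
  have : \det G * w 0 i' = \sum_j (w *m L) 0 j * R j i'.
    have /rowP/(_ i') wEi := wE.
    by rewrite [LHS]mxE [RHS]mxE in wEi.
  move=> /(congr1 (fun x => `|x|)); rewrite normrM => {}wE.
  have le_w : `|w 0 i'| <= `|\sum_j (w *m L) 0 j * R j i'|.
    by rewrite -wE ler_peMl // -gtz0_ge1 normr_gt0.
  apply: le_trans (ler_wpM2r (ltW t0Z) le_w) _.
  apply: le_trans (ler_wpM2r (ltW t0Z) (ler_norm_sum _ _ _)) _.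
  rewrite mulr_suml [leRHS]mulr_suml; apply: ler_sum => j _.
  rewrite normrM mulrAC [leRHS]mulrC; apply: ler_pM => //.
    by rewrite mulr_ge0 ?ler0n.
  by rewrite (bigD1 i') //= lerDl sumr_ge0.
have Wt : W * t%:R <= n%:R * rho * (M * t%:R + E * W).
  rewrite /W mulr_suml; apply: le_trans (ler_sum _ (fun i' _ => wt i')) _.
  by rewrite sumr_const card_ord -[leLHS]mulr_natl mulrA.
have le_t' : 2 * n%:R * rho * E <= t%:R.
  have : 0 <= 2 * n%:R * rho * E by rewrite !mulr_ge0.
  by move: le_t; set x := (2 * n%:R * rho * E); lia.
have Wt2 : 2 * n%:R * rho * E * W <= t%:R * W by rewrite ler_wpM2r.
have WM : W <= 2 * n%:R * rho * M.
  rewrite -(ler_pM2r t0Z).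
  have H : 2 * (W * t%:R) <= 2 * (n%:R * rho * (M * t%:R + E * W)).
    by rewrite ler_pM2l.
  have HE : 2 * (n%:R * rho * (M * t%:R + E * W)) =
    2 * n%:R * rho * M * t%:R + 2 * n%:R * rho * E * W by ring.
  rewrite {}HE in H; rewrite [leRHS]mulrC in Wt2.
  move: H Wt2; set X := W * _; set Y := _ * M * _; set Z := _ * E * _.
  clearbody X Y Z; lia.
rewrite -wi; apply: le_trans (_ : W <= _).
  by rewrite /W (bigD1 i) //= lerDl sumr_ge0.
apply: le_trans WM _; rewrite ler_wpM2r // /K -addrA lerDl; exact: addr_ge0.
Qed.

(** An elementary row operation on row [k], unimodular when [v 0 k = 0]: its inverse is then the
    operation with [- v]. *)
Definition add_row {S : pzRingType} {n m} (k : 'I_n) (v : 'rV[S]_n)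
  (A : 'M[S]_(n, m)) : 'M[S]_(n, m) := A + delta_mx k 0 *m (v *m A).

Lemma add_rowE (S : pzRingType) n m k (v : 'rV[S]_n) (A : 'M[S]_(n, m)) i j :
  add_row k v A i j = A i j + (if i == k then \sum_l v 0 l * A l j else 0).
Proof.
rewrite !mxE big_ord1 !mxE eqxx andbT; case: (i == k); last by rewrite mul0r.
by rewrite mul1r.
Qed.

Lemma mul_add_row (S : comPzRingType) n m k (c v : 'rV[S]_n) (A : 'M[S]_(n, m)) :
  c *m add_row k v A = (c + c 0 k *: v) *m A.
Proof.
rewrite /add_row mulmxDl mulmxDr (mulmxA c) -colE [col k c]mx11_scalar.
by rewrite mul_scalar_mx mxE -scalemxAl.
Qed.

Lemma in_lattice_add_row n m (k : 'I_n) (v : 'rV[int]_n) (A : 'M[int]_(n, m)) x :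
  v 0 k = 0 -> in_lattice (add_row k v A) x <-> in_lattice A x.
Proof.
move=> vk; split=> [[c ->]|[c ->]].
  by exists (c + c 0 k *: v); rewrite mul_add_row.
exists (c - c 0 k *: v); rewrite mul_add_row; congr (_ *m _).
by rewrite !mxE vk mulr0 subr0 subrK.
Qed.

Lemma cvp_add_row n m (k : 'I_n) (v : 'rV[{poly int}]_n)
    (B : 'M[{poly int}]_(n, m)) z h :
  v 0 k = 0 -> cvp (add_row k v B) z h -> cvp B z h.
Proof.
move=> vk; apply: cvp_eq_lattice => t x.
have -> : mx_at t (add_row k v B) = add_row k (mx_at t v) (mx_at t B).
  by rewrite /mx_at /add_row map_mxD !map_mxM map_delta_mx.
by apply: in_lattice_add_row; rewrite mxE vk /horner_eval horner0.
Qed.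

Lemma size_comp_affine (p : {poly int}) (N r : nat) :
  (0 < N)%N -> size (p \Po affine N r) = size p.
Proof.
move=> N0; apply: size_comp_poly2; rewrite /affine size_polyDl.
  by rewrite size_scale ?size_polyX // pnatr_eq0 -lt0n.
rewrite size_scale ?size_polyX ?pnatr_eq0 -?lt0n //.
by rewrite (leq_ltn_trans (size_polyC_leq1 _)).
Qed.

Lemma coef_comp_affine (p : {poly int}) (N r d : nat) :
  (0 < N)%N -> (size p <= d.+1)%N -> (p \Po affine N r)`_d = p`_d * N%:R ^+ d.
Proof.
move=> N0; elim: d p => [|d IH] p szp.
  by rewrite (size1_polyC szp) comp_polyC !coefC expr0 mulr1.
have [q qE] : exists q : {poly int}, p = q * 'X + (p`_0)%:P.
  by exists (\poly_(i < size p) p`_i.+1); apply/polyP => -[|i];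
    rewrite coefD coefMX coefC /= ?add0r // addr0 coef_poly;
    case: ltnP => // le_i; rewrite nth_default // ltnW.
have szq : (size q <= d.+1)%N.
  apply/leq_sizeP => i lt_i; have /polyP/(_ i.+1) := qE.
  rewrite coefD coefMX coefC addr0 /= => <-.
  by rewrite nth_default // (leq_trans szp).
have szqa : ((q \Po affine N r)`_d.+1) = 0.
  by rewrite nth_default // size_comp_affine.
rewrite {1}qE comp_polyD comp_polyM comp_polyX comp_polyC coefD coefC addr0.
rewrite {2}/affine mulrDr -scalerAr coefD coefZ coefMX /= coefMC szqa mul0r addr0.
rewrite IH // qE coefD coefMX coefC addr0 exprS /=; ring.
Qed.

Lemma lead_add_row n m (d : 'I_n -> nat) (B : 'M[{poly int}]_(n, m))
    (i k : 'I_n) (x : int) :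
  d i = d k ->
  lead_mx d (add_row k (x%:P *: delta_mx 0 i) B)
    = add_row k (x *: delta_mx 0 i) (lead_mx d B).
Proof.
move=> dik; apply/matrixP => l j; rewrite mxE !add_rowE coefD mxE.
case: eqP => [->|_]; last by rewrite coef0.
congr (_ + _); rewrite coef_sum; apply: eq_bigr => p _.
rewrite !mxE eqxx /=; case: eqP => [->|_]; first by rewrite !mulr1 coefCM dik.
by rewrite !mulr0 !mul0r coef0.
Qed.

(* Along [t = N s + r] with [N = `|a 0 k|] the leading coefficient of a row of
   degree [d] gets multiplied by [N ^+ d], so in the relation [a] all
   coefficients of rows of degree less than [d k] become divisible by [a 0 k]. *)
Lemma cancel_leading n m (d : 'I_n -> nat) (B : 'M[{poly int}]_(n, m))
    (a : 'rV[int]_n) (k : 'I_n) (r : nat) :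
  (forall i j, (size (B i j) <= (d i).+1)%N) ->
  a *m lead_mx d B = 0 -> a 0 k != 0 ->
  (forall i, i != k -> a 0 i != 0 -> (d i < d k)%N) ->
  exists2 v : 'rV[{poly int}]_n, v 0 k = 0 &
    forall j, (size (add_row k v (mx_affine `|a 0%R k| r B) k j) <= d k)%N.
Proof.
move=> szB aL ak0 top; set N := absz (a 0 k); pose sg := sgz (a 0 k).
have N0 : (0 < N)%N by rewrite absz_gt0.
(* Up to sign, [a 0 i / a 0 k] times the ratio [N ^ (d k - d i)] of the scalings of the two leading
   coefficients. Dividing by [a 0 k] lowers the exponent by one, which is possible because
   [d i < d k] whenever [a 0 i] is nonzero. *)
pose b i : int := if i == k then 0 else sg * a 0 i * N%:R ^+ (d k - d i).-1.
pose v : 'rV[{poly int}]_n := \row_i (b i *: 'X^(d k - d i)).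
exists v; first by rewrite mxE /b eqxx scale0r.
move=> j; rewrite add_rowE eqxx; set p := _ + _.
have b0 i : b i != 0 -> i != k /\ (d i < d k)%N.
  rewrite /b; case: (eqVneq i k) => [_|ik]; first by rewrite eqxx.
  move=> bi; split=> //; apply: top => //; apply: contraNneq bi => ->.
  by rewrite mulr0 mul0r.
have szp : (size p <= (d k).+1)%N.
  apply: leq_trans (size_polyD _ _) _; rewrite geq_max mxE size_comp_affine //.
  rewrite szB /=; apply: leq_trans (size_sum _ _ _) _; apply/bigmax_leqP => i _.
  rewrite mxE; have [->|/b0[_ lt_i]] := eqVneq (b i) 0.
    by rewrite scale0r mul0r size_poly0.
  apply: leq_trans (size_polyMleq _ _) _.
  have : (size (b i *: 'X^(d k - d i)) <= (d k - d i).+1)%N.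
    by rewrite (leq_trans (size_scale_leq _ _)) // size_polyXn.
  have := szB i j; rewrite mxE size_comp_affine //; lia.
suff p0 : p`_(d k) = 0.
  apply/leq_sizeP => i; rewrite leq_eqVlt => /predU1P[<-//|lt_i].
  by rewrite nth_default // (leq_trans szp).
have NZ : N%:R != 0 :> int by rewrite pnatr_eq0 -lt0n.
apply: (mulfI NZ); rewrite mulr0.
have /rowP/(_ j) := aL; rewrite mxE [RHS]mxE => aLj.
suff -> : N%:R * p`_(d k) =
    sg * N%:R ^+ d k * \sum_i a 0 i * lead_mx d B i j by rewrite aLj mulr0.
have sgN : sg * a 0 k = N%:R by rewrite natz /N abszE /sg; lia.
rewrite coefD coef_sum mulrDr mxE coef_comp_affine // mulr_sumr.
rewrite [RHS](bigD1 k) //= [X in _ + N%:R * X](bigD1 k) //=.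
rewrite [v 0 k]mxE {1}/b eqxx scale0r mul0r coef0 add0r.
congr (_ + _); first by rewrite mxE -sgN; ring.
rewrite mulr_sumr; apply: eq_bigr => i ik; rewrite !mxE /b (negPf ik).
rewrite -scalerAl coefZ coefXnM.
have [->|ai0] := eqVneq (a 0 i) 0; first by rewrite !(mulr0, mul0r).
have lt_i := top i ik ai0; rewrite ltnNge leq_subr /=.
rewrite subKn ?(ltnW lt_i) // coef_comp_affine //.
have -> : N%:R ^+ d k = N%:R * N%:R ^+ (d k - d i).-1 * N%:R ^+ d i :> int.
  by rewrite -exprS prednK ?subn_gt0 // -exprD subnK // ltnW.
ring.
Qed.

(** The first hypothesis is the outer induction on the total size of the rows. The inner induction
    is on the sum of the absolute values of the [a i]: Euclid steps lower it until a single row of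
    top degree occurs in the relation, and then [cancel_leading] lowers the degree of that row on
    every progression. *)
Lemma cvp_lead_relation n m (d : 'I_n -> nat) :
  (forall (s : 'I_n -> nat) (B : 'M[{poly int}]_(n, m)) z (h : {poly int}),
     (\sum_i s i < \sum_i (d i).+1)%N ->
     (forall i j, (size (B i j) <= s i)%N) ->
     eventually (fun t => h.[t%:R] != 0) -> cvp B z h) ->
  forall (a : 'rV[int]_n) (B : 'M[{poly int}]_(n, m)) z (h : {poly int}),
    a != 0 -> (forall i j, (size (B i j) <= (d i).+1)%N) ->
    a *m lead_mx d B = 0 -> eventually (fun t => h.[t%:R] != 0) -> cvp B z h.
Proof.
move=> IH a B z h; move: {2}(\sum_i _)%N (leqnn (\sum_i `|a 0%R i|)) => A.
elim: A a B z h => [|A IHA] a B z h leA a0 szB aL hh.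
  case/eqP: a0; apply/rowP => i; rewrite mxE; apply/eqP.
  by move: leA; rewrite leqn0 sum_nat_eq0 => /forall_inP/(_ i isT); rewrite absz_eq0.
have [i0 ai0] : exists i, a 0 i != 0.
  apply/existsP; apply: contraNT a0 => /existsPn a0.
  by apply/eqP/rowP => i; rewrite mxE; apply/eqP/negbNE/a0.
pose k := [arg max_(i > i0 | a 0 i != 0) d i].
have [ak0 kmax] : a 0 k != 0 /\ forall i, a 0 i != 0 -> (d i <= d k)%N.
  by rewrite /k; case: arg_maxnP.
(* One step of Euclid's algorithm on the coefficients of two rows of the same
   degree. *)
have euclid i j : i != j -> d i = d j -> a 0 j != 0 ->
    (`|a 0%R j| <= `|a 0%R i|)%N -> cvp B z h.
  move=> ij dij aj0 le_ji.
  (* With this sign, adding [x] times row [i] to row [j] replaces the coefficient [a i] of the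
     relation by one of absolute value [|a i| - |a j|]. *)
  pose x : int := sgz (a 0 i) * sgz (a 0 j).
  pose v : 'rV[int]_n := x *: delta_mx 0 i.
  have vj : v 0 j = 0 by rewrite !mxE eq_sym (negPf ij) andbF mulr0.
  have avj : (a - a 0 j *: v) 0 j = a 0 j.
    by rewrite mxE [X in _ + X]mxE [X in - X]mxE vj mulr0 subr0.
  apply: (@cvp_add_row _ _ j (x%:P *: delta_mx 0 i)).
    by rewrite !mxE eq_sym (negPf ij) andbF mulr0.
  apply: (IHA (a - a 0 j *: v)) => //.
  - rewrite -ltnS; apply: leq_trans leA; rewrite !(bigD1 (P := xpredT) i) //=.
    rewrite -addSn leq_add //; last first.
      by apply: leq_sum => l li; rewrite !mxE (negPf li) andbF !mulr0 subr0.
    rewrite !mxE !eqxx mulr1 /x; move: le_ji aj0.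
    set p := a 0 i; set q := a 0 j => le_ji q0.
    have -> : p - q * (sgz p * sgz q) = sgz p * (`|p| - `|q|).
      have -> : `|p| = sgz p * p by lia.
      have -> : `|q| = sgz q * q by lia.
      have -> : p = sgz p * sgz p * p by nia.
      rewrite !sgzM !sgz_id; nia.
    have sp : absz (sgz p) = 1%N by lia.
    rewrite abszM sp mul1n; lia.
  - by apply: contra_neq aj0 => av0; rewrite -avj av0 mxE.
  - move=> l j'; rewrite add_rowE; case: eqP => [->|_]; last by rewrite addr0.
    apply: leq_trans (size_polyD _ _) _; rewrite geq_max szB /=.
    apply: leq_trans (size_sum _ _ _) _; apply/bigmax_leqP => p _.
    rewrite !mxE eqxx /=; case: eqP => [->|_]; last by rewrite mulr0 mul0r size_poly0.
    by rewrite mulr1 mul_polyC (leq_trans (size_scale_leq _ _)) // -dij.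
  - rewrite lead_add_row // mul_add_row -/v -[RHS]aL avj.
    by rewrite subrK.
have [/existsP[j /and3P[jk aj0 /eqP djk]]|] :=
  boolP [exists j, [&& j != k, a 0 j != 0 & d j == d k]].
  have [le_jk|/ltnW le_kj] := leqP `|a 0%R j| `|a 0%R k|.
    by apply: (euclid k j); rewrite // eq_sym.
  by apply: (euclid j k).
move=> /existsPn top.
have N0 : (0 < `|a 0%R k|)%N by rewrite absz_gt0.
apply: (cvp_affine _ _ _ _ _ _ N0) => r.
have [|v vk szv] := cancel_leading _ _ d B a k r szB aL ak0.
  move=> i ik ai; have := top i; rewrite ik ai /= => dik.
  by rewrite ltn_neqAle dik kmax.
apply: (cvp_add_row _ _ k v) => //.
apply: (IH (fun i => if i == k then d i else (d i).+1)).
- rewrite !(bigD1 (P := xpredT) k) //= eqxx -addSn leq_add2l.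
  by apply: leq_sum => i /negPf->.
- move=> i j; case: eqP => [->|/eqP ik]; first exact: szv.
  by rewrite add_rowE (negPf ik) addr0 mxE size_comp_affine.
- apply: eventually_mono (eventually_affine _ _ r N0 hh) => t.
  by rewrite horner_affine.
Qed.

Lemma cvp_row' n m (B : 'M[{poly int}]_(n.+1, m)) (k : 'I_n.+1) z h :
  (forall j, B k j = 0) -> cvp (row' k B) z h -> cvp B z h.
Proof.
move=> Bk; apply: cvp_eq_lattice => t v.
have row0 : row k (mx_at t B) = 0.
  by apply/rowP => j; rewrite !mxE Bk /horner_eval horner0.
have -> : mx_at t (row' k B) = row' k (mx_at t B).
  by apply/matrixP => i j; rewrite !mxE.
split=> [/(in_lattice_row'D _ _ _ _ _ 0)|/(in_latticeD1 _ _ _ k)[c _]].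
  by rewrite scale0r addr0.
by rewrite row0 scaler0 subr0.
Qed.

(** Induction on the number of rows plus the sum of their size bounds. The number of rows is counted
    because deleting a zero row may lower nothing else. If all bounds are positive, either the
    leading vectors are independent and the rows are reduced, or a relation lowers the sum. *)
Lemma parametric_cvp n m (B : 'M[{poly int}]_(n, m)) z (h : {poly int}) :
  h != 0 -> cvp B z h.
Proof.
move=> /horner_eventually_neq0.
pose s i := (\max_j size (B i j))%N.
have : forall i j, (size (B i j) <= s i)%N by move=> i j; apply: leq_bigmax.
move: {2}(n + _)%N (leqnn (n + \sum_i s i)) => M.
move: s; elim: M => [|M IH] in n B z h *.
  case: n B => // B s _ _; apply: reduced_cvp.
  exists 0, (fun=> 0%N), (fun=> 1); split=> //; apply: eventuallyW => t.
  by split=> // [[]//|e M _ _ []].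
move=> s le_M szB hh.
case: (pickP (fun i => s i == 0%N)) => [k /eqP sk|s0].
  case: n B s k sk szB le_M => [|n] B s k sk szB le_M; first by case: k sk.
  apply: (cvp_row' _ _ _ k).
    move=> j; apply/eqP; rewrite -size_poly_eq0 -leqn0.
    by have := szB k j; rewrite sk.
  apply: (IH _ _ _ _ (fun i => s (lift k i))) => // [|i j].
    rewrite -ltnS; apply: leq_trans le_M; rewrite addSn ltnS leq_add2l.
    by rewrite (bigD1_ord k) //= leq_addl.
  by rewrite mxE.
pose d i := (s i).-1.
have sd i : s i = (d i).+1 by rewrite prednK // lt0n s0.
have szB' i j : (size (B i j) <= (d i).+1)%N by rewrite -sd.
have [kerL|] := pselect (forall a : 'rV[int]_n, a *m lead_mx d B = 0 -> a = 0).
  exact: reduced_cvp (lead_free_reduced _ _ d B szB' kerL) hh.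
move=> /existsNP[a /not_implyP[aL /eqP a0]].
apply: (@cvp_lead_relation _ _ d _ a) => // s' B' z' h' lt_s.
apply: IH; rewrite -ltnS; apply: leq_trans le_M.
by rewrite ltn_add2l; under [ltnRHS]eq_bigr do rewrite sd.
Qed.

(** * Rational functions and common denominators *)

Lemma fraction_numden (S : idomainType) (x : {fraction S}) :
  exists p q : S, q != 0 /\ x = tofrac p / tofrac q.
Proof.
have [r ->] : exists r : {ratio S}, x = (\pi_({fraction S}) r)%qT.
  by exists (repr x); rewrite reprK.
exists (frac r).1, (frac r).2; have q0 := denom_ratioP r; split=> //.
apply: (canRL (mulfK _)); first by rewrite tofrac_eq0.
rewrite -[_ * _]/(FracField.mul _ _) !piE; apply/eqmodP => /=.
rewrite FracField.equivfE /FracField.mulf /= !numden_Ratio ?mulf_neq0 ?oner_neq0 //.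
by rewrite !mulr1 mulrC.
Qed.

(** The general [phi] covers two uses: rational functions over integer polynomials, and rational
    numbers over integers. *)
Lemma common_denominator (S : idomainType) (F : comNzRingType)
    (phi : {rmorphism S -> F}) m (y : 'rV[F]_m) :
  (forall i, exists p q : S, q != 0 /\ y 0 i * phi q = phi p) ->
  exists (z : 'rV[S]_m) (h : S),
    h != 0 /\ forall i, y 0 i * phi h = phi (z 0 i).
Proof.
move=> /fin_all_exists[p /fin_all_exists[q pq]].
exists (\row_i (p i * \prod_(j | j != i) q j)), (\prod_i q i).
split=> [|i]; first by apply/prodf_neq0 => i _; have [] := pq i.
by rewrite mxE (bigD1 i) //= !rmorphM mulrA; have [_ ->] := pq i.
Qed.

Lemma ratfun_common_denominator m (x : 'rV[{fraction {poly rat}}]_m) :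
  exists (z : 'rV[{poly int}]_m) (h : {poly int}), h != 0 /\
    forall i, x 0 i * tofrac (map_poly intr h) = tofrac (map_poly intr (z 0 i)).
Proof.
pose phi : {rmorphism {poly int} -> {fraction {poly rat}}} :=
  (@tofrac {poly rat} \o map_poly intr)%FUN.
apply: (common_denominator _ _ phi) => i /=.
have [P [Q [Q0 ->]]] := fraction_numden _ (x 0 i).
have [[p [a a0 pE]] [q [b b0 qE]]] := (rat_poly_scale P, rat_poly_scale Q).
have aQ : a%:~R != 0 :> rat by rewrite intr_eq0.
have bQ : b%:~R != 0 :> rat by rewrite intr_eq0.
exists (b *: p), (a *: q); split.
  rewrite -mul_polyC mulf_eq0 polyC_eq0 negb_or a0 /=; apply: contra_neq Q0 => q0.
  by rewrite qE q0 rmorph0 scaler0.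
rewrite mulrAC; apply: (canLR (mulfK _)); first by rewrite tofrac_eq0.
rewrite -!tofracM; congr tofrac; rewrite pE qE !map_polyZ /=.
by rewrite -!scalerAl -!scalerAr !scalerA !(mulVf, mulfV) // !scale1r.
Qed.

Lemma tofrac_horner_neq0 (q : {poly rat}) (a : rat) :
  q.[a] != 0 -> tofrac q != 0.
Proof.
by rewrite tofrac_eq0; apply: contraNneq => ->; rewrite horner0.
Qed.

(** This holds even where [q] vanishes, because the value comes from a fraction whose denominator is
    nonzero at [a] and the cross-multiplied identity is one of polynomials. *)
Lemma ratfun_value_cross (r : {fraction {poly rat}}) (a y : rat)
    (p q : {poly rat}) :
  ratfun_value r a y -> r * tofrac q = tofrac p -> y * q.[a] = p.[a].
Proof.
move=> [p' [q' [-> q'0 ->]]] rE.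
have /eqP : tofrac (p * q') = tofrac (p' * q).
  by rewrite !tofracM -rE mulrAC mulfVK // (tofrac_horner_neq0 _ a).
rewrite tofrac_eq => /eqP pq.
by rewrite mulrAC -hornerM -pq hornerM mulfK.
Qed.

Lemma ratfun_value_inj (r : {fraction {poly rat}}) (a y y' : rat) :
  ratfun_value r a y -> ratfun_value r a y' -> y = y'.
Proof.
move=> ry [p [q [rE q0 ->]]]; apply: (canRL (mulfK q0)).
apply: ratfun_value_cross ry _.
by rewrite rE mulfVK // (tofrac_horner_neq0 _ a).
Qed.

(** * Return to Euclidean distances and rational targets *)

Lemma lattice_atE m n (f : 'I_n -> 'rV[{poly int}]_m) t v :
  lattice_at f t v <-> in_lattice (mx_at t (\matrix_i f i)) v.
Proof.
have sumE (c : 'I_n -> int) :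
  \sum_(i < n) [tuple eval_polyrV (f i) t | i < n]`_i *~ c i
    = (\row_i c i) *m mx_at t (\matrix_i f i).
  rewrite mulmx_sum_row; apply: eq_bigr => i _.
  rewrite -tnth_nth tnth_mktuple mxE -scaler_int intz; congr (_ *: _).
  by apply/rowP => j; rewrite !mxE.
split=> [[c ->]|[c ->]]; first by exists (\row_i c i); apply: sumE.
exists [ffun i => c 0 i]; rewrite sumE; congr (_ *m _).
by apply/rowP => i; rewrite mxE ffunE.
Qed.

(** Both squared distances are the integral ones divided by the same [h ^ 2]. *)
Lemma edist_le (R : realType) m (u v z : 'rV[int]_m) (y : 'rV[rat]_m) (h : int) :
  h != 0 -> (forall i, y 0 i * h%:~R = (z 0 i)%:~R) ->
  (edist R u y <= edist R v y) = (sqnorm (h *: u - z) <= sqnorm (h *: v - z)).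
Proof.
move=> h0 yE; have hQ : h%:~R != 0 :> rat by rewrite intr_eq0.
have sumE (w : 'rV[int]_m) :
  \sum_i (map_mx intr w - map_mx ratr y : 'rV[R]_m) 0 i ^+ 2
    = ratr ((sqnorm (h *: w - z))%:~R / h%:~R ^+ 2).
  rewrite /sqnorm rmorph_sum mulr_suml rmorph_sum; apply: eq_bigr => i _.
  rewrite !mxE -(ratr_int R (w 0 i)) -rmorphB -rmorphXn /=; congr ratr.
  rewrite rmorphXn rmorphB rmorphM /= -yE; field.
  exact: hQ.
rewrite /edist /enorm ler_sqrt ?sumr_ge0 // => [|i _]; last exact: sqr_ge0.
by rewrite !sumE ler_rat ler_pM2r ?ler_int // invr_gt0 exprn_even_gt0.
Qed.

Lemma closest_vectorP (R : realType) m n (f : 'I_n -> 'rV[{poly int}]_m) t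
    (y : 'rV[rat]_m) (z : 'rV[int]_m) (h : int) u :
  h != 0 -> (forall i, y 0 i * h%:~R = (z 0 i)%:~R) ->
  closest (mx_at t (\matrix_i f i)) z h u ->
  closest_vector R (lattice_at f t) y u.
Proof.
move=> h0 yE [uL umin]; split=> [|v /lattice_atE vL]; first exact/lattice_atE.
by rewrite (@edist_le _ _ _ _ z _ h) // umin.
Qed.

Lemma closest_vector_exists (R : realType) m n (f : 'I_n -> 'rV[{poly int}]_m)
    t (y : 'rV[rat]_m) :
  exists u, closest_vector R (lattice_at f t) y u.
Proof.
have [i|z [h [h0 yE]]] := common_denominator int rat intr m y.
  exists (numq (y 0 i)), (denq (y 0 i)); split; first exact: denq_neq0.
  by rewrite -{1}[y 0 i]divq_num_den mulfVK // intr_eq0 denq_neq0.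
have [u hu] := closest_exists _ _ (mx_at t (\matrix_i f i)) z h.
by exists u; apply: closest_vectorP yE hu.
Qed.

Theorem theorem1p3 (R : realType) (m n : nat)
    (f : 'I_n -> 'rV[{poly int}]_m) (x : 'rV[{fraction {poly rat}}]_m) :
  exists u : nat -> 'rV[int]_m,
    (forall i : 'I_m, eventually_quasi_poly (fun t : nat => (u t 0 i)%:~R)) /\
    (forall (t : nat) (y : 'rV[rat]_m),
      (forall i : 'I_m, ratfun_value (x 0 i) t%:R (y 0 i)) ->
      closest_vector R (lattice_at f t) y (u t)).
Proof.
have [z [h [h0 xE]]] := ratfun_common_denominator m x.
have [u hu [T hT]] := parametric_cvp _ _ (\matrix_i f i) z h h0.
have [T' hT'] := horner_eventually_neq0 h h0.
pose value t (y : 'rV[rat]_m) := forall i, ratfun_value (x 0 i) t%:R (y 0 i).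
(* The conclusion concerns every [t] at which the target is defined, so small [t] are treated one by
   one, with 0 as default at poles. Changing finitely many values does not affect eventual
   quasi-polynomiality. *)
have small t : exists w, forall y, value t y ->
    closest_vector R (lattice_at f t) y w.
  have [[y hy]|noy] := pselect (exists y, value t y); last first.
    by exists 0 => y hy; case: noy; exists y.
  have [w hw] := closest_vector_exists R m n f t y; exists w => y' hy'.
  suff -> : y' = y by [].
  by apply/rowP => i; apply: ratfun_value_inj (hy' i) (hy i).
have [w hw] := choice small.
exists (fun t => if (maxn T T' <= t)%N then u t else w t); split.
  move=> i; apply: eqp_eventually_eq (hu i).
  by exists (maxn T T') => t ->.
move=> t y hy; case: ifP => [|_]; last exact: hw.
rewrite geq_max => /andP[/hT hc /hT' ht].
apply: closest_vectorP ht _ hc => i; rewrite mxE /horner_eval !horner_intr.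
exact: ratfun_value_cross (hy i) (xE i).
Qed.
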